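(* Let $E$ be a nonempty finite set and $r$ a positive integer. Let $\mathcal{F}:\mathbf{Hyperfields}\to\mathbf{FuzzyRings}_{wk}$ be the powerset functor, and let $\mathscr{M}^{hyp}_{E,r}:\mathbf{Hyperfields}\to\mathbf{Sets}$ and $\mathscr{M}^{fuzzy}_{E,r}:\mathbf{FuzzyRings}_{wk}\to\mathbf{Sets}$ be the functors of rank $r$ matroids on $E$ with coefficients. Then there is a natural isomorphism $$\mathscr{M}^{hyp}_{E,r}\;\cong\;\mathscr{M}^{fuzzy}_{E,r}\circ\mathcal{F},$$ implemented by applying the identification $F^\times\cong\mathcal{F}(F)^\times$, $x\mapsto\{x\}$ (together with $0\mapsto\{0\}$) to the components (values) of Grassmann-Plücker functions. In particular, for every hyperfield $F$ there is a bijection between matroids over $F$ and matroids over the fuzzy ring $\mathcal{F}(F)$.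
   Context: **Hyperfields.** For a set $A$, $\mathcal{P}^*(A)$ is the set of nonempty subsets of $A$. A hyperoperation on $A$ is a map $+:A\times A\to\mathcal{P}^*(A)$; it extends to $\mathcal{P}^*(A)$ by $X+Y=\bigcup_{x\in X,y\in Y}(x+y)$ (elements are identified with singletons). A canonical hypergroup is a set $A$ with a hyperoperation $+$ such that: $a+b=b+a$; there is an element $0$ with $a+0=\{a\}$ for all $a$; for each $a$ there is a unique $-a\in A$ with $0\in a+(-a)$; $(a+b)+c=a+(b+c)$; and $a\in b+c$ if and only if $c\in a+(-b)$. A hyperring is a set $R$ with a multiplication $\times$ and a hyperoperation $+$ such that $(R,+)$ is a canonical hypergroup, $(R,\times)$ is a unital commutative monoid, $a(b+c)=ab+ac$, and $a\times 0=0$. A hyperfield is a hyperring in which $(R\smallsetminus\{0\},\times)$ is a group. A homomorphism is a map $f:R\to S$ with $f(0)=0$, $f(1)=1$, $f(ab)=f(a)f(b)$ and $f(a+b)\subseteq f(a)+f(b)$. $\mathbf{Hyperfields}$ is the category of hyperfields and homomorphisms. **Fuzzy rings.** A fuzzy ring is a tuple $(K;+,\times;\varepsilon,K_0)$ with $K$ a set, $+,\times$ binary operations on $K$, $\varepsilon\in K$, $K_0\subset K$, such that, with $K^\times$ the group of multiplicative units: (FR0) $(K,+)$ and $(K,\times)$ are commutative monoids with neutral elements $0$ and $1$; (FR1) $0\times a=0$ for all $a\in K$; (FR2) $a(b+c)=ab+ac$ for all $b,c\in K$, $a\in K^\times$; (FR3) $\varepsilon^2=1$; (FR4) $K_0+K_0\subseteq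 K_0$, $K\times K_0\subseteq K_0$, $0\in K_0$, $1\notin K_0$; (FR5) for $a\in K^\times$, $1+a\in K_0$ if and only if $a=\varepsilon$; (FR6) if $a+b\in K_0$ and $c+d\in K_0$ then $ac+\varepsilon bd\in K_0$; (FR7) if $a+b(c+d)\in K_0$ then $a+bc+bd\in K_0$. A weak morphism $K\to L$ is a group homomorphism $f:K^\times\to L^\times$ such that for all $a_1,\dots,a_n\in K^\times$, if $\sum a_i\in K_0$ then $\sum f(a_i)\in L_0$. $\mathbf{FuzzyRings}_{wk}$ is the category of fuzzy rings and weak morphisms. **The functor $\mathcal{F}$.** For a hyperfield $F$, $\mathcal{F}(F)$ is the fuzzy ring with underlying set $\mathcal{P}^*(F)$, $A+B=\bigcup_{a\in A,b\in B}(a+b)$, $A\times B=\{ab\mid a\in A,b\in B\}$, $\varepsilon=\{-1\}$, $0=\{0_F\}$, $1=\{1_F\}$, and $\mathcal{F}(F)_0=\{A\mid 0_F\in A\}$. Its units are the singletons $\{x\}$ with $x\in F^\times$. For a homomorphism $f$, $\mathcal{F}(f)$ is the weak morphism $\{x\}\mapsto\{f(x)\}$ on units. **Matroids.** A Grassmann-Plücker function of rank $r$ on $E$ with coefficients in a hyperfield $F$ is a function $\varphi:E^r\to F$ that is not identically zero, is alternating ($\varphi(x_{\sigma(1)},\dots,x_{\sigma(r)})=-\varphi(x_1,\dots,x_r)$ for odd permutations $\sigma$, and $\varphi(x_1,\dots,x_r)=0$ if the $x_i$ are not pairwise distinct), and satisfies, for all $x_1,\dots,x_{r+1}\in E$ and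 $y_1,\dots,y_{r-1}\in E$, $$0\in\sum_{k=1}^{r+1}(-1)^k\varphi(x_1,\dots,\hat{x_k},\dots,x_{r+1})\,\varphi(x_k,y_1,\dots,y_{r-1})$$ (hypersum in $F$). A Grassmann-Plücker function of rank $r$ on $E$ with coefficients in a fuzzy ring $K$ is a function $\varphi:E^r\to K^\times\cup\{0\}$ that is not identically zero, is $\varepsilon$-alternating ($\varphi(x_{\sigma(1)},\dots,x_{\sigma(r)})=\varepsilon\varphi(x_1,\dots,x_r)$ for odd $\sigma$, and $\varphi(x_1,\dots,x_r)=0$ if the $x_i$ are not pairwise distinct), and satisfies, for all $x_i,y_j\in E$, $$\sum_{k=1}^{r+1}\varepsilon^k\varphi(x_1,\dots,\hat{x_k},\dots,x_{r+1})\times\varphi(x_k,y_1,\dots,y_{r-1})\in K_0.$$ In both cases two such functions are equivalent if one is obtained from the other by multiplication by a unit, and a rank $r$ matroid on $E$ with coefficients in $F$ (resp. $K$) is an equivalence class of such functions. $\mathscr{M}^{hyp}_{E,r}(F)$ and $\mathscr{M}^{fuzzy}_{E,r}(K)$ are the sets of these matroids; a morphism $f$ acts by pushforward $[\varphi]\mapsto[f\circ\varphi]$ (a weak morphism being extended by $f(0)=0$). *)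

(* Defs.v *)
From mathcomp Require Import all_boot perm.
From mathcomp Require Import boolp classical_sets.

Set Implicit Arguments.
Unset Strict Implicit.
Unset Printing Implicit Defensive.

Local Open Scope classical_set_scope.

(** * Categories, functors, natural isomorphisms *)

Record category := Category {
  obj :> Type;
  hom : obj -> obj -> Type;
  idc : forall X, hom X X;
  compc : forall X Y Z, hom Y Z -> hom X Y -> hom X Z;
  compc1 : forall X Y (f : hom X Y), compc f (idc X) = f;
  comp1c : forall X Y (f : hom X Y), compc (idc Y) f = f;
  compcA : forall W X Y Z (h : hom Y Z) (g : hom X Y) (f : hom W X),
    compc h (compc g f) = compc (compc h g) f }.

Arguments hom {c}.
Arguments idc {c}.
Arguments compc {c X Y Z}.

Record functor (C D : category) := Functor {
  fobj :> C -> D;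
  fmap : forall X Y : C, hom X Y -> hom (fobj X) (fobj Y);
  fmap_id : forall X : C, fmap (idc X) = idc (fobj X);
  fmap_comp : forall (X Y Z : C) (g : hom Y Z) (f : hom X Y),
    fmap (compc g f) = compc (fmap g) (fmap f) }.

Arguments fmap {C D} _ {X Y}.

Section FunctorComposition.
Variables (C D E : category) (G : functor D E) (F : functor C D).

Let cfmap (X Y : C) (f : hom X Y) : hom (G (F X)) (G (F Y)) :=
  fmap G (fmap F f).

Lemma functor_comp_id (X : C) : cfmap (idc X) = idc (G (F X)).
Proof. by rewrite /cfmap !fmap_id. Qed.

Lemma functor_comp_comp (X Y Z : C) (g : hom Y Z) (f : hom X Y) :
  cfmap (compc g f) = compc (cfmap g) (cfmap f).
Proof. by rewrite /cfmap !fmap_comp. Qed.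

Definition functor_comp : functor C E :=
  Functor functor_comp_id functor_comp_comp.

End FunctorComposition.

Definition is_iso (C : category) (X Y : C) (f : hom X Y) : Prop :=
  exists g : hom Y X, compc g f = idc X /\ compc f g = idc Y.

Record nat_iso (C D : category) (F G : functor C D) := NatIso {
  component :> forall X : C, hom (F X) (G X);
  naturality : forall (X Y : C) (f : hom X Y),
    compc (component Y) (fmap F f) = compc (fmap G f) (component X);
  component_iso : forall X : C, is_iso (component X) }.

Definition Sets : category :=
  @Category Type (fun A B => A -> B) (fun A x => x)
    (fun A B C g f x => g (f x))
    (fun A B f => erefl) (fun A B f => erefl)
    (fun A B C D h g f => erefl).

(** * Hyperfields *)

Definition hyper_ext (A : Type) (add : A -> A -> set A) (X Y : set A) : set A :=
  \bigcup_(x in X) \bigcup_(y in Y) add x y.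

Record is_canonical_hypergroup (A : Type) (zero : A) (opp : A -> A)
    (add : A -> A -> set A) : Prop := {
  chg_neq0 : forall a b, add a b !=set0;
  chg_comm : forall a b, add a b = add b a;
  chg_zero : forall a, add a zero = [set a];
  chg_opp : forall a, unique (fun b => add a b zero) (opp a);
  chg_assoc : forall a b c,
    hyper_ext add (add a b) [set c] = hyper_ext add [set a] (add b c);
  chg_rev : forall a b c, add b c a <-> add a (opp b) c }.

Record is_comm_monoid (A : Type) (one : A) (mul : A -> A -> A) : Prop := {
  cm_assoc : associative mul;
  cm_comm : commutative mul;
  cm_one : left_id one mul }.

Record is_hyperring (A : Type) (zero one : A) (opp : A -> A)
    (add : A -> A -> set A) (mul : A -> A -> A) : Prop := {
  hr_add : is_canonical_hypergroup zero opp add;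
  hr_mul : is_comm_monoid one mul;
  hr_distr : forall a b c, mul a @` add b c = add (mul a b) (mul a c);
  hr_mul0 : forall a, mul a zero = zero }.

Record is_hyperfield (A : Type) (zero one : A) (opp : A -> A)
    (add : A -> A -> set A) (mul : A -> A -> A) : Prop := {
  hf_ring : is_hyperring zero one opp add mul;
  hf_one_neq0 : one <> zero;
  hf_mul_neq0 : forall a b, a <> zero -> b <> zero -> mul a b <> zero;
  hf_inv : forall a, a <> zero -> exists2 b, b <> zero & mul a b = one }.

Record hyperfield := Hyperfield {
  hf_sort :> Type;
  hzero : hf_sort;
  hone : hf_sort;
  hopp : hf_sort -> hf_sort;
  hadd : hf_sort -> hf_sort -> set hf_sort;
  hmul : hf_sort -> hf_sort -> hf_sort;
  hf_axioms : is_hyperfield hzero hone hopp hadd hmul }.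

Arguments hzero {h}.
Arguments hone {h}.

Record hf_hom (F G : hyperfield) := HfHom {
  hf_fun :> F -> G;
  hf_hom0 : hf_fun hzero = hzero;
  hf_hom1 : hf_fun hone = hone;
  hf_homM : {morph hf_fun : a b / hmul a b >-> hmul a b};
  hf_homD : forall a b, hf_fun @` hadd a b `<=` hadd (hf_fun a) (hf_fun b) }.

Definition hexp (F : hyperfield) (x : F) (n : nat) : F := iter n (hmul x) hone.

Definition hsetD (F : hyperfield) : set F -> set F -> set F :=
  hyper_ext (@hadd F).

Definition hsetM (F : hyperfield) (X Y : set F) : set F :=
  [set hmul x y | x in X & y in Y].

Section HyperfieldTheory.
Variable F : hyperfield.
Implicit Types (a b c d x y : F) (A B C : set F).

Lemma haddC a b : hadd a b = hadd b a.
Proof. exact: (chg_comm (hr_add (hf_ring (hf_axioms F)))). Qed.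
Lemma hadd_neq0 a b : hadd a b !=set0.
Proof. exact: (chg_neq0 (hr_add (hf_ring (hf_axioms F)))). Qed.
Lemma hadd0 a : hadd a hzero = [set a].
Proof. exact: (chg_zero (hr_add (hf_ring (hf_axioms F)))). Qed.
Lemma haddN a : hadd a (hopp a) hzero.
Proof. by have [] := chg_opp (hr_add (hf_ring (hf_axioms F))) a. Qed.
Lemma hopp_uniq a b : hadd a b hzero -> b = hopp a.
Proof.
by have [_ u] := chg_opp (hr_add (hf_ring (hf_axioms F))) a => /u ->.
Qed.
Lemma haddA a b c :
  hyper_ext (@hadd F) (hadd a b) [set c] = hyper_ext (@hadd F) [set a] (hadd b c).
Proof. exact: (chg_assoc (hr_add (hf_ring (hf_axioms F)))). Qed.
Lemma hmulA : associative (@hmul F).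
Proof. exact: (cm_assoc (hr_mul (hf_ring (hf_axioms F)))). Qed.
Lemma hmulC : commutative (@hmul F).
Proof. exact: (cm_comm (hr_mul (hf_ring (hf_axioms F)))). Qed.
Lemma hmul1x : left_id hone (@hmul F).
Proof. exact: (cm_one (hr_mul (hf_ring (hf_axioms F)))). Qed.
Lemma hmulx1 x : hmul x hone = x.
Proof. by rewrite hmulC hmul1x. Qed.
Lemma hmulx0 x : hmul x hzero = hzero.
Proof. exact: (hr_mul0 (hf_ring (hf_axioms F))). Qed.
Lemma hmul0x x : hmul hzero x = hzero.
Proof. by rewrite hmulC hmulx0. Qed.
Lemma hdistr a b c : hmul a @` hadd b c = hadd (hmul a b) (hmul a c).
Proof. exact: (hr_distr (hf_ring (hf_axioms F))). Qed.
Lemma hone_neq0 : (hone : F) <> hzero.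
Proof. exact: (hf_one_neq0 (hf_axioms F)). Qed.
Lemma hmul_neq0 a b : a <> hzero -> b <> hzero -> hmul a b <> hzero.
Proof. exact: (hf_mul_neq0 (hf_axioms F)). Qed.
Lemma hinv a : a <> hzero -> exists2 b, b <> hzero & hmul a b = hone.
Proof. exact: (hf_inv (hf_axioms F)). Qed.

Lemma hmulxN1 x : hmul x (hopp hone) = hopp x.
Proof.
apply: hopp_uniq; rewrite -[X in hadd X]hmulx1 -hdistr.
by exists hzero; [exact: haddN | exact: hmulx0].
Qed.

Lemma hmulN1x x : hmul (hopp hone) x = hopp x.
Proof. by rewrite hmulC hmulxN1. Qed.

Lemma hoppK : involutive (@hopp F).
Proof. by move=> a; rewrite -(@hopp_uniq (hopp a) a) // haddC; apply: haddN. Qed.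

Lemma hsetDP A B z :
  hsetD A B z <-> exists a b, [/\ A a, B b & hadd a b z].
Proof.
split=> [[a Aa [b Bb ?]]|[a [b [Aa Bb ?]]]]; first by exists a, b.
by exists a => //; exists b.
Qed.

Lemma hsetMP A B z :
  hsetM A B z <-> exists a b, [/\ A a, B b & hmul a b = z].
Proof.
split=> [[a Aa [b Bb ?]]|[a [b [Aa Bb ?]]]]; first by exists a, b.
by exists a => //; exists b.
Qed.

Lemma hsetDC : commutative (@hsetD F).
Proof.
move=> A B; apply/seteqP; split=> z /hsetDP[a [b [? ? abz]]]; apply/hsetDP;
by exists b, a; split=> //; rewrite haddC.
Qed.

Lemma hsetDA : associative (@hsetD F).
Proof.
move=> A B C; apply/seteqP; split=> z /hsetDP.
  move=> [a [t [Aa /hsetDP[b [c [Bb Cc bct]]] atz]]].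
  have : hyper_ext (@hadd F) [set a] (hadd b c) z by exists a => //; exists t.
  rewrite -haddA => -[u abu [_ -> ucz]].
  by apply/hsetDP; exists u, c; split=> //; apply/hsetDP; exists a, b.
move=> [u [c [/hsetDP[a [b [Aa Bb abu]]] Cc ucz]]].
have : hyper_ext (@hadd F) (hadd a b) [set c] z by exists u => //; exists c.
rewrite haddA => -[_ -> [t bct atz]].
by apply/hsetDP; exists a, t; split=> //; apply/hsetDP; exists b, c.
Qed.

Lemma hsetD0 A : hsetD A [set hzero] = A.
Proof.
apply/seteqP; split=> z; first by move=> /hsetDP[a [_ [Aa ->]]]; rewrite hadd0 => ->.
by move=> Az; apply/hsetDP; exists z, hzero; split=> //; rewrite hadd0.
Qed.

Lemma hsetMC : commutative (@hsetM F).
Proof.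
move=> A B; apply/seteqP; split=> z /hsetMP[a [b [? ? abz]]]; apply/hsetMP;
by exists b, a; split=> //; rewrite hmulC.
Qed.

Lemma hsetMA : associative (@hsetM F).
Proof.
move=> A B C; apply/seteqP; split=> z /hsetMP.
  move=> [a [t [Aa /hsetMP[b [c [Bb Cc <-]]] <-]]].
  apply/hsetMP; exists (hmul a b), c; split=> //; last by rewrite hmulA.
  by apply/hsetMP; exists a, b.
move=> [u [c [/hsetMP[a [b [Aa Bb <-]]] Cc <-]]].
apply/hsetMP; exists a, (hmul b c); split=> //; last by rewrite hmulA.
by apply/hsetMP; exists b, c.
Qed.

Lemma hsetM1 A : hsetM [set hone] A = A.
Proof.
apply/seteqP; split=> z; first by move=> /hsetMP[_ [a [-> Aa <-]]]; rewrite hmul1x.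
by move=> Az; apply/hsetMP; exists hone, z; rewrite hmul1x.
Qed.

Lemma hsetM_set1 x y : hsetM [set x] [set y] = [set hmul x y].
Proof.
apply/seteqP; split=> z; first by move=> /hsetMP[_ [_ [-> -> <-]]].
by move=> ->; apply/hsetMP; exists x, y.
Qed.

End HyperfieldTheory.

Section HyperfieldHomTheory.

Lemma hf_hom_eq (F G : hyperfield) (f g : hf_hom F G) : f =1 g -> f = g.
Proof.
case: f g => [f f0 f1 fM fD] [g g0 g1 gM gD] /= /funext fg.
by move: f0 f1 fM fD; rewrite fg => *; congr HfHom; apply: Prop_irrelevance.
Qed.

Lemma hf_homN (F G : hyperfield) (f : hf_hom F G) x : f (hopp x) = hopp (f x).
Proof.
apply: hopp_uniq; apply: (@hf_homD _ _ f); exists hzero; last exact: hf_hom0.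
exact: haddN.
Qed.

Lemma hf_hom_neq0 (F G : hyperfield) (f : hf_hom F G) x :
  x <> hzero -> f x <> hzero.
Proof.
move=> /hinv[y _ xy] fx0; apply: (@hone_neq0 G).
by rewrite -(hf_hom1 f) -xy hf_homM fx0 hmul0x.
Qed.

Lemma hf_hom_exp (F G : hyperfield) (f : hf_hom F G) x n :
  f (hexp x n) = hexp (f x) n.
Proof. by elim: n => [|n IHn] /=; rewrite ?hf_hom1 // hf_homM IHn. Qed.

Lemma hf_id_homD (F : hyperfield) (a b : F) : id @` hadd a b `<=` hadd a b.
Proof. by rewrite image_id. Qed.

Definition hf_id (F : hyperfield) : hf_hom F F :=
  @HfHom F F id erefl erefl (fun _ _ => erefl) (@hf_id_homD F).

Variables (F G H : hyperfield) (g : hf_hom G H) (f : hf_hom F G).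

Lemma hf_comp_hom0 : g (f hzero) = hzero.
Proof. by rewrite !hf_hom0. Qed.

Lemma hf_comp_hom1 : g (f hone) = hone.
Proof. by rewrite !hf_hom1. Qed.

Lemma hf_comp_homM : {morph (g \o f) : a b / hmul a b >-> hmul a b}.
Proof. by move=> a b /=; rewrite !hf_homM. Qed.

Lemma hf_comp_homD a b : (g \o f) @` hadd a b `<=` hadd (g (f a)) (g (f b)).
Proof.
by move=> _ [c abc <-]; apply: hf_homD; exists (f c) => //; apply: hf_homD; exists c.
Qed.

Definition hf_comp : hf_hom F H :=
  @HfHom F H (g \o f) hf_comp_hom0 hf_comp_hom1 hf_comp_homM hf_comp_homD.

End HyperfieldHomTheory.

Lemma hf_comp1 F G (f : hf_hom F G) : hf_comp f (hf_id F) = f.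
Proof. exact: hf_hom_eq. Qed.

Lemma hf_1comp F G (f : hf_hom F G) : hf_comp (hf_id G) f = f.
Proof. exact: hf_hom_eq. Qed.

Lemma hf_compA F G H I (h : hf_hom H I) (g : hf_hom G H) (f : hf_hom F G) :
  hf_comp h (hf_comp g f) = hf_comp (hf_comp h g) f.
Proof. exact: hf_hom_eq. Qed.

Definition Hyperfields : category := Category hf_comp1 hf_1comp hf_compA.

(** * Fuzzy rings *)

Definition monoid_unit (A : Type) (one : A) (mul : A -> A -> A) (a : A) : Prop :=
  exists b, mul a b = one.

Record is_fuzzy_ring (K : Type) (zero one eps : K) (add mul : K -> K -> K)
    (K0 : set K) : Prop := {
  fr_add : is_comm_monoid zero add;
  fr_mul : is_comm_monoid one mul;
  fr_mul0 : forall a, mul zero a = zero;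
  fr_distr : forall a b c, monoid_unit one mul a ->
    mul a (add b c) = add (mul a b) (mul a c);
  fr_eps2 : mul eps eps = one;
  fr_null_add : forall a b, K0 a -> K0 b -> K0 (add a b);
  fr_null_mul : forall a b, K0 b -> K0 (mul a b);
  fr_null0 : K0 zero;
  fr_null1 : ~ K0 one;
  fr_null_eps : forall a, monoid_unit one mul a -> (K0 (add one a) <-> a = eps);
  fr_null_prod : forall a b c d, K0 (add a b) -> K0 (add c d) ->
    K0 (add (mul a c) (mul eps (mul b d)));
  fr_null_distr : forall a b c d, K0 (add a (mul b (add c d))) ->
    K0 (add (add a (mul b c)) (mul b d)) }.

Record fuzzy_ring := FuzzyRing {
  fr_sort :> Type;
  fzero : fr_sort;
  fone : fr_sort;
  feps : fr_sort;
  fadd : fr_sort -> fr_sort -> fr_sort;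
  fmul : fr_sort -> fr_sort -> fr_sort;
  fnull : set fr_sort;
  fr_axioms : is_fuzzy_ring fzero fone feps fadd fmul fnull }.

Arguments fzero {f}.
Arguments fone {f}.
Arguments feps {f}.
Arguments fnull {f}.

Definition funit (K : fuzzy_ring) (a : K) : Prop := monoid_unit fone (@fmul K) a.

Record funits (K : fuzzy_ring) := FUnit { fval :> K; funitP : funit fval }.

Definition fexp (K : fuzzy_ring) (x : K) (n : nat) : K := iter n (fmul x) fone.

Section FuzzyRingTheory.
Variable K : fuzzy_ring.
Implicit Types a b c d : K.

Lemma faddC : commutative (@fadd K).
Proof. exact: (cm_comm (fr_add (fr_axioms K))). Qed.
Lemma fmulA : associative (@fmul K).
Proof. exact: (cm_assoc (fr_mul (fr_axioms K))). Qed.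
Lemma fmulC : commutative (@fmul K).
Proof. exact: (cm_comm (fr_mul (fr_axioms K))). Qed.
Lemma fadd0x : left_id fzero (@fadd K).
Proof. exact: (cm_one (fr_add (fr_axioms K))). Qed.
Lemma fmul1x : left_id fone (@fmul K).
Proof. exact: (cm_one (fr_mul (fr_axioms K))). Qed.
Lemma faddx0 a : fadd a fzero = a.
Proof. by rewrite faddC fadd0x. Qed.
Lemma fmulx1 a : fmul a fone = a.
Proof. by rewrite fmulC fmul1x. Qed.
Lemma fmul0x a : fmul fzero a = fzero.
Proof. exact: (fr_mul0 (fr_axioms K)). Qed.
Lemma fmulx0 a : fmul a fzero = fzero.
Proof. by rewrite fmulC fmul0x. Qed.

Lemma fone_neq0 : (fone : K) <> fzero.
Proof.
move=> e; apply: (fr_null1 (fr_axioms K)); rewrite e.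
exact: fr_null0 (fr_axioms K).
Qed.

Lemma funit_neq0 a : funit a -> a <> fzero.
Proof. by move=> [b ab] a0; apply: fone_neq0; rewrite -ab a0 fmul0x. Qed.

Lemma funit1 : funit (fone : K).
Proof. by exists fone; rewrite fmul1x. Qed.

Lemma funit_eps : funit (feps : K).
Proof. by exists feps; apply: (fr_eps2 (fr_axioms K)). Qed.

Lemma funitM a b : funit a -> funit b -> funit (fmul a b).
Proof.
move=> [a' aa'] [b' bb']; exists (fmul b' a').
by rewrite fmulA -(fmulA a) bb' fmulx1.
Qed.

Lemma funits_eq (u v : funits K) : (u : K) = v -> u = v.
Proof.
by case: u v => [u pu] [v pv] /= uv; subst v; congr FUnit; apply: Prop_irrelevance.
Qed.

Definition fu1 : funits K := FUnit funit1.
Definition fu_eps : funits K := FUnit funit_eps.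
Definition fuM (u v : funits K) : funits K := FUnit (funitM (funitP u) (funitP v)).

End FuzzyRingTheory.

Record weak_morphism (K L : fuzzy_ring) := WeakMorphism {
  wm_fun :> funits K -> funits L;
  wm_mul : {morph wm_fun : u v / fuM u v >-> fuM u v};
  wm_null : forall s : seq (funits K),
    fnull (\big[@fadd K/fzero]_(a <- s) (a : K)) ->
    fnull (\big[@fadd L/fzero]_(a <- s) (wm_fun a : L)) }.

(* The extension of a weak morphism to the zero element; only its values
   on the units and on zero are meaningful. *)
Definition wm_ext (K L : fuzzy_ring) (f : funits K -> funits L) (x : K) : L :=
  if pselect (funit x) is left ux then f (FUnit ux) else fzero.

Section WeakMorphismTheory.

Lemma wm_eq (K L : fuzzy_ring) (f g : weak_morphism K L) : f =1 g -> f = g.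
Proof.
case: f g => [f fM f0] [g gM g0] /= /funext fg.
by move: fM f0; rewrite fg => *; congr WeakMorphism; apply: Prop_irrelevance.
Qed.

Definition wm_id (K : fuzzy_ring) : weak_morphism K K :=
  @WeakMorphism K K id (fun _ _ => erefl) (fun _ h => h).

Section Composition.
Variables (K L M : fuzzy_ring) (g : weak_morphism L M) (f : weak_morphism K L).

Lemma wm_comp_mul : {morph (g \o f) : u v / fuM u v >-> fuM u v}.
Proof. by move=> u v /=; rewrite !wm_mul. Qed.

Lemma wm_comp_null (s : seq (funits K)) :
  fnull (\big[@fadd K/fzero]_(a <- s) (a : K)) ->
  fnull (\big[@fadd M/fzero]_(a <- s) ((g \o f) a : M)).
Proof.
move=> /(wm_null f) Hf; have := @wm_null _ _ g (map f s).
by rewrite !big_map; apply.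
Qed.

Definition wm_comp : weak_morphism K M :=
  @WeakMorphism K M (g \o f) wm_comp_mul wm_comp_null.

End Composition.

Variables (K L : fuzzy_ring) (f : weak_morphism K L).
Implicit Types a b x : K.

Lemma wm_ext_unit x (ux : funit x) : wm_ext f x = f (FUnit ux).
Proof.
by rewrite /wm_ext; case: pselect => // ux'; congr (fval (f _)); apply: funits_eq.
Qed.

Lemma wm_ext_nonunit x : ~ funit x -> wm_ext f x = fzero.
Proof. by rewrite /wm_ext; case: pselect. Qed.

Lemma wm_ext0 : wm_ext f fzero = fzero.
Proof. by apply: wm_ext_nonunit => /funit_neq0. Qed.

Lemma wm_ext_funit x : funit x -> funit (wm_ext f x).
Proof. by move=> ux; rewrite (wm_ext_unit ux); apply: funitP. Qed.

Lemma wm_extM a b : (funit a \/ a = fzero) -> (funit b \/ b = fzero) ->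
  wm_ext f (fmul a b) = fmul (wm_ext f a) (wm_ext f b).
Proof.
case=> [ua|->]; last by rewrite fmul0x wm_ext0 fmul0x.
case=> [ub|->]; last by rewrite fmulx0 wm_ext0 fmulx0.
rewrite (wm_ext_unit ua) (wm_ext_unit ub) (wm_ext_unit (funitM ua ub)).
have := congr1 (@fval L) (wm_mul f (FUnit ua) (FUnit ub)).
by move=> /= <-; congr (fval (f _)); apply: funits_eq.
Qed.

Lemma wm1 : f (fu1 K) = fu1 L.
Proof.
have e : fuM (f (fu1 K)) (f (fu1 K)) = f (fu1 K).
  by rewrite -wm_mul; congr (f _); apply: funits_eq; rewrite /= fmul1x.
apply: funits_eq => /=; case: (funitP (f (fu1 K))) => y xy.
by rewrite -xy -[in RHS]e /= -fmulA xy fmulx1.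
Qed.

Lemma wm_ext1 : wm_ext f fone = fone.
Proof.
by rewrite (wm_ext_unit (funit1 K)) -/(fu1 K) wm1.
Qed.

Lemma wm_eps : f (fu_eps K) = fu_eps L.
Proof.
apply: funits_eq => /=.
apply/(fr_null_eps (fr_axioms L)); first exact: funitP.
have := @wm_null _ _ f [:: fu1 K; fu_eps K].
rewrite !big_cons !big_nil !faddx0 wm1 /=; apply.
by apply/(fr_null_eps (fr_axioms K)) => //; apply: funit_eps.
Qed.

Lemma wm_ext_eps : wm_ext f feps = feps.
Proof. by rewrite (wm_ext_unit (funit_eps K)) -/(fu_eps K) wm_eps. Qed.

Lemma funit_exp (M : fuzzy_ring) (x : M) n : funit x -> funit (fexp x n).
Proof.
by move=> ux; elim: n => [|n IHn] /=; [apply: funit1 | apply: funitM].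
Qed.

Lemma wm_ext_eps_exp n : wm_ext f (fexp feps n) = fexp feps n.
Proof.
elim: n => [|n IHn] /=; first exact: wm_ext1.
rewrite wm_extM; first by rewrite wm_ext_eps IHn.
  by left; apply: funit_eps.
by left; apply/funit_exp/funit_eps.
Qed.

Lemma wm_ext_null n (t : 'I_n -> K) : (forall k, funit (t k) \/ t k = fzero) ->
  fnull (\big[@fadd K/fzero]_(k < n) t k) ->
  fnull (\big[@fadd L/fzero]_(k < n) wm_ext f (t k)).
Proof.
move=> ht; suff [s [-> ->]] : exists s : seq (funits K),
    \big[@fadd K/fzero]_(k < n) t k = \big[@fadd K/fzero]_(a <- s) (a : K) /\
    \big[@fadd L/fzero]_(k < n) wm_ext f (t k) =
    \big[@fadd L/fzero]_(a <- s) (f a : L) by apply: wm_null.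
elim: (index_enum _) => [|k e [s [IH1 IH2]]].
  by exists [::]; rewrite !big_nil.
rewrite !big_cons IH1 IH2; case: (ht k) => [uk|->].
  by exists (FUnit uk :: s); rewrite !big_cons (wm_ext_unit uk).
by exists s; rewrite wm_ext0 !fadd0x.
Qed.

End WeakMorphismTheory.

Lemma wm_ext_id (K : fuzzy_ring) (x : K) : (funit x \/ x = fzero) ->
  wm_ext (wm_id K) x = x.
Proof. by case=> [ux|->]; rewrite ?wm_ext0 // (wm_ext_unit _ ux). Qed.

Lemma wm_ext_comp (K L M : fuzzy_ring) (g : weak_morphism L M)
    (f : weak_morphism K L) (x : K) :
  wm_ext (wm_comp g f) x = wm_ext g (wm_ext f x).
Proof.
case: (pselect (funit x)) => ux; last by rewrite !(wm_ext_nonunit _ ux) wm_ext0.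
rewrite !(wm_ext_unit _ ux) (wm_ext_unit _ (funitP (f (FUnit ux)))) /=.
by congr (fval (g _)); apply: funits_eq.
Qed.

Lemma wm_comp1 K L (f : weak_morphism K L) : wm_comp f (wm_id K) = f.
Proof. exact: wm_eq. Qed.

Lemma wm_1comp K L (f : weak_morphism K L) : wm_comp (wm_id L) f = f.
Proof. exact: wm_eq. Qed.

Lemma wm_compA K L M N (h : weak_morphism M N) (g : weak_morphism L M)
    (f : weak_morphism K L) : wm_comp h (wm_comp g f) = wm_comp (wm_comp h g) f.
Proof. exact: wm_eq. Qed.

Definition FuzzyRings_wk : category := Category wm_comp1 wm_1comp wm_compA.

(** * The powerset functor *)

Record pset (F : hyperfield) := PSet { pset_set :> set F; pset_neq0 : pset_set !=set0 }.

Section Powerset.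
Variable F : hyperfield.
Implicit Types A B C D : pset F.

Lemma pset_eq A B : (A : set F) = B -> A = B.
Proof.
by case: A B => [A hA] [B hB] /= AB; subst B; congr PSet; apply: Prop_irrelevance.
Qed.

Definition psingle (x : F) : pset F := @PSet F [set x] (ex_intro _ x erefl).

Lemma psetD_neq0 A B : hsetD A B !=set0.
Proof.
have [[a Aa] [b Bb]] := (pset_neq0 A, pset_neq0 B).
by have [z abz] := hadd_neq0 a b; exists z; apply/hsetDP; exists a, b.
Qed.

Lemma psetM_neq0 A B : hsetM A B !=set0.
Proof.
have [[a Aa] [b Bb]] := (pset_neq0 A, pset_neq0 B).
by exists (hmul a b); apply/hsetMP; exists a, b.
Qed.

Definition psetD A B : pset F := PSet (psetD_neq0 A B).
Definition psetM A B : pset F := PSet (psetM_neq0 A B).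
Definition pset_null : set (pset F) := [set A | (A : set F) hzero].

Lemma psetM_single x y : psetM (psingle x) (psingle y) = psingle (hmul x y).
Proof. by apply: pset_eq; apply: hsetM_set1. Qed.

Lemma psetM_unitP A : monoid_unit (psingle hone) psetM A <->
  exists2 x, x <> hzero & A = psingle x.
Proof.
split; last first.
  move=> [x /hinv[y _ xy] ->]; exists (psingle y).
  by rewrite psetM_single xy.
move=> [B AB1]; have [[a Aa] [b Bb]] := (pset_neq0 A, pset_neq0 B).
have AB x : (A : set F) x -> hmul x b = hone.
  move=> Ax; suff : (psetM A B : set F) (hmul x b) by rewrite AB1.
  by apply/hsetMP; exists x, b.
exists a; first by move=> a0; apply: (@hone_neq0 F); rewrite -(AB a Aa) a0 hmul0x.
apply: pset_eq; apply/seteqP; split=> [x Ax|x -> //] /=.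
by rewrite -[x]hmulx1 -(AB a Aa) (hmulC a) hmulA AB // hmul1x.
Qed.

Lemma powerset_fuzzy : is_fuzzy_ring (psingle hzero) (psingle hone)
  (psingle (hopp hone)) psetD psetM pset_null.
Proof.
have NN : hmul (hopp hone) (hopp hone) = hone :> F by rewrite hmulxN1 hoppK.
split.
- split=> [A B C|A B|A]; apply: pset_eq => /=; first exact: hsetDA.
    exact: hsetDC.
  by rewrite hsetDC hsetD0.
- split=> [A B C|A B|A]; apply: pset_eq => /=; [exact: hsetMA|exact: hsetMC|].
  exact: hsetM1.
- move=> A; apply: pset_eq; apply/seteqP; split=> z /=.
    by move=> /hsetMP[_ [a [-> Aa <-]]]; rewrite hmul0x.
  have [a Aa] := pset_neq0 A.
  by move=> ->; apply/hsetMP; exists hzero, a; rewrite hmul0x.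
- move=> A B C /psetM_unitP[x x0 ->]; apply: pset_eq; apply/seteqP; split=> z /=.
    move=> /hsetMP[_ [y [-> /hsetDP[b [c [Bb Cc bcy]]] <-]]].
    apply/hsetDP; exists (hmul x b), (hmul x c); split.
    + by apply/hsetMP; exists x, b.
    + by apply/hsetMP; exists x, c.
    by rewrite -hdistr; exists y.
  move=> /hsetDP[_ [_ [/hsetMP[_ [b [-> Bb <-]]] /hsetMP[_ [c [-> Cc <-]]]]]].
  rewrite -hdistr => -[y bcy <-]; apply/hsetMP; exists x, y; split=> //.
  by apply/hsetDP; exists b, c.
- by rewrite psetM_single NN.
- move=> A B A0 B0; apply/hsetDP; exists hzero, hzero; split=> //.
  by rewrite hadd0.
- move=> A B B0; have [a Aa] := pset_neq0 A.
  by apply/hsetMP; exists a, hzero; rewrite hmulx0.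
- by [].
- by move=> /esym; apply: hone_neq0.
- move=> A /psetM_unitP[x x0 ->]; split.
    by move=> /hsetDP[_ [_ [-> -> /hopp_uniq ->]]].
  move=> /(congr1 (@pset_set F)) /= /seteqP[/(_ x erefl) /= -> _].
  by apply/hsetDP; exists hone, (hopp hone); split=> //; apply: haddN.
- move=> A B C D /hsetDP[a [b [Aa Bb /hopp_uniq eb]]].
  move=> /hsetDP[c [d [Cc Dd /hopp_uniq ed]]].
  apply/hsetDP; exists (hmul a c), (hmul (hopp hone) (hmul b d)); split.
  + by apply/hsetMP; exists a, c.
  + apply/hsetMP; exists (hopp hone), (hmul b d); split=> //.
    by apply/hsetMP; exists b, d.
  suff -> : hmul b d = hmul a c by rewrite hmulN1x; apply: haddN.
  rewrite eb ed -(hmulxN1 a) -(hmulN1x c) hmulA -(hmulA a) NN.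
  by rewrite hmulx1.
- move=> A B C D /hsetDP[a [u [Aa /hsetMP[b [t [Bb CDt <-]]] abt]]].
  have /hsetDP[c [d [Cc Dd cdt]]] := CDt.
  have : hsetD A (hsetD (hsetM B C) (hsetM B D)) hzero.
    apply/hsetDP; exists a, (hmul b t); split=> //.
    apply/hsetDP; exists (hmul b c), (hmul b d); split.
    + by apply/hsetMP; exists b, c.
    + by apply/hsetMP; exists b, d.
    by rewrite -hdistr; exists t.
  by rewrite hsetDA.
Qed.

Definition fuzzy_powerset : fuzzy_ring := FuzzyRing powerset_fuzzy.

End Powerset.

Section PowersetMap.
Variables (F G : hyperfield) (f : hf_hom F G).

Definition pimage (A : pset F) : pset G :=
  @PSet G (f @` A) (let: ex_intro x Ax := pset_neq0 A in
                    ex_intro _ (f x) (ex_intro2 _ _ x Ax erefl)).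

Lemma pimage_single x : pimage (psingle x) = psingle (f x).
Proof. by apply: pset_eq; apply: image_set1. Qed.

Lemma pimage_unit (A : funits (fuzzy_powerset F)) :
  funit (pimage (fval A) : fuzzy_powerset G).
Proof.
case: A => A /= /psetM_unitP[x x0 ->]; rewrite pimage_single.
by apply/psetM_unitP; exists (f x) => //; apply: hf_hom_neq0.
Qed.

(* As the units of [fuzzy_powerset F] are singletons (see [psetM_unitP]),
   taking the direct image is the map {x} |-> {f x} (see [pimage_single]). *)
Definition powerset_map_fun (A : funits (fuzzy_powerset F)) :
    funits (fuzzy_powerset G) :=
  FUnit (pimage_unit A).

Lemma powerset_map_mul :
  {morph powerset_map_fun : A B / fuM A B >-> fuM A B}.
Proof.
move=> [A +] [B +]; move=> uA uB; apply: funits_eq => /=.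
case/psetM_unitP: uA => x _ ->; case/psetM_unitP: uB => y _ ->.
by rewrite psetM_single !pimage_single psetM_single hf_homM.
Qed.

Lemma powerset_map_null (s : seq (funits (fuzzy_powerset F))) :
  fnull (\big[@fadd (fuzzy_powerset F)/fzero]_(A <- s) (A : fuzzy_powerset F)) ->
  fnull (\big[@fadd (fuzzy_powerset G)/fzero]_(A <- s)
           (powerset_map_fun A : fuzzy_powerset G)).
Proof.
suff: pimage (\big[@fadd (fuzzy_powerset F)/fzero]_(A <- s) (A : fuzzy_powerset F)) `<=`
      (\big[@fadd (fuzzy_powerset G)/fzero]_(A <- s)
          (powerset_map_fun A : fuzzy_powerset G) : pset G).
  by move=> sub h0; apply: sub; exists hzero => //; apply: hf_hom0.
elim: s => [|A s IHs]; first by rewrite !big_nil pimage_single hf_hom0.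
rewrite !big_cons => _ [z /hsetDP[a [b [Aa sb abz]]] <-].
apply/hsetDP; exists (f a), (f b); split; first by exists a.
  by apply: IHs; exists b.
by apply: hf_homD; exists z.
Qed.

Definition powerset_map : weak_morphism (fuzzy_powerset F) (fuzzy_powerset G) :=
  WeakMorphism powerset_map_mul powerset_map_null.

End PowersetMap.

Lemma powerset_map_id (F : hyperfield) :
  powerset_map (hf_id F) = wm_id (fuzzy_powerset F).
Proof.
by apply: wm_eq => A; apply: funits_eq; apply: pset_eq; apply: image_id.
Qed.

Lemma powerset_map_comp (F G H : hyperfield) (g : hf_hom G H) (f : hf_hom F G) :
  powerset_map (hf_comp g f) = wm_comp (powerset_map g) (powerset_map f).
Proof.
by apply: wm_eq => A; apply: funits_eq; apply: pset_eq; rewrite /= image_comp.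
Qed.

Definition powerset_functor : functor Hyperfields FuzzyRings_wk :=
  @Functor Hyperfields FuzzyRings_wk fuzzy_powerset powerset_map
    powerset_map_id powerset_map_comp.

(** * Matroids with coefficients *)

Section Tuples.
Variables (E : Type) (r : nat).

Definition perm_args (x : r.-tuple E) (s : 'S_r) : r.-tuple E :=
  [tuple tnth x (s i) | i < r].

Definition omit (k : 'I_r.+1) (x : r.+1.-tuple E) : r.-tuple E :=
  [tuple tnth x (lift k i) | i < r].

(* The tuple (a, y_1, ..., y_(r-1)), when r is positive. *)
Definition prepend (a : E) (y : r.-1.-tuple E) : r.-tuple E :=
  [tuple nth a (a :: y) i | i < r].

End Tuples.

Section HyperfieldMatroids.
Variables (E : finType) (r : nat).

(* In the Plucker relations, the k-th summand for k = 1, ..., r + 1 is the one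
   of index k - 1 : 'I_r.+1, hence the exponent k.+1. *)
Record is_hyp_gp (F : hyperfield) (phi : r.-tuple E -> F) : Prop := {
  hgp_neq0 : exists x, phi x <> hzero;
  hgp_odd : forall x (s : 'S_r), odd_perm s ->
    phi (perm_args x s) = hopp (phi x);
  hgp_uniq : forall x : r.-tuple E, ~~ uniq x -> phi x = hzero;
  hgp_plucker : forall (x : r.+1.-tuple E) (y : r.-1.-tuple E),
    (\big[@hsetD F/[set hzero]]_(k < r.+1)
       [set hmul (hmul (hexp (hopp hone) k.+1) (phi (omit k x)))
                 (phi (prepend (tnth x k) y))]) hzero }.

Definition hyp_class (F : hyperfield) (phi : r.-tuple E -> F) :
    set (r.-tuple E -> F) :=
  [set psi | exists2 u, u <> hzero & psi = (fun x => hmul u (phi x))].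

Record hyp_matroid (F : hyperfield) := HypMatroid {
  hmat_set :> set (r.-tuple E -> F);
  hmatP : exists2 phi, is_hyp_gp phi & hmat_set = hyp_class phi }.

Definition hyp_matroid_of (F : hyperfield) (phi : r.-tuple E -> F)
    (gp : is_hyp_gp phi) : hyp_matroid F :=
  HypMatroid (ex_intro2 _ _ phi gp erefl).

Lemma hmat_eq (F : hyperfield) (M N : hyp_matroid F) :
  (M : set _) = N -> M = N.
Proof.
by case: M N => [M hM] [N hN] /= MN; subst N; congr HypMatroid; apply: Prop_irrelevance.
Qed.

Lemma hyp_class_refl (F : hyperfield) (phi : r.-tuple E -> F) : hyp_class phi phi.
Proof.
by exists hone; [exact: hone_neq0 | apply/funext=> x; rewrite hmul1x].
Qed.

Lemma hyp_class_eq (F : hyperfield) (phi psi : r.-tuple E -> F) :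
  hyp_class phi psi -> hyp_class psi = hyp_class phi.
Proof.
move=> [u u0 ->]; have [v v0 uv] := hinv u0.
apply/seteqP; split=> _ [w w0 ->].
  exists (hmul w u); first exact: hmul_neq0.
  by apply/funext=> x; rewrite hmulA.
exists (hmul w v); first exact: hmul_neq0.
by apply/funext=> x; rewrite hmulA -(hmulA w) (hmulC v) uv hmulx1.
Qed.

Section Pushforward.
Variables (F G : hyperfield) (f : hf_hom F G).

Lemma hyp_gp_push (phi : r.-tuple E -> F) : is_hyp_gp phi -> is_hyp_gp (f \o phi).
Proof.
move=> [[x0 hx0] odd dup pl]; split.
- by exists x0; apply: hf_hom_neq0.
- by move=> x s /odd /= ->; rewrite hf_homN.
- by move=> x /dup /= ->; rewrite hf_hom0.
move=> x y; set S := (X in X hzero).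
suff sub : f @` (\big[@hsetD F/[set hzero]]_(k < r.+1)
       [set hmul (hmul (hexp (hopp hone) k.+1) (phi (omit k x)))
                 (phi (prepend (tnth x k) y))]) `<=` S.
  by apply: sub; exists hzero; [exact: pl | exact: hf_hom0].
rewrite /S; elim: (index_enum _) => [|k e IH].
  by rewrite !big_nil image_set1 hf_hom0.
rewrite !big_cons => _ [z /hsetDP[a [b [-> sb abz]]] <-].
apply/hsetDP; eexists; exists (f b); split; [exact: erefl | by apply: IH; exists b|].
rewrite /comp -(hf_hom1 f) -hf_homN -hf_hom_exp -!hf_homM.
by apply: (@hf_homD _ _ f); exists z.
Qed.

Lemma hyp_class_push (phi psi : r.-tuple E -> F) :
  hyp_class phi psi -> hyp_class (f \o phi) (f \o psi).
Proof.
move=> [u u0 ->]; exists (f u); first exact: hf_hom_neq0.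
by apply/funext=> x /=; rewrite hf_homM.
Qed.

Definition hyp_push_set (M : set (r.-tuple E -> F)) : set (r.-tuple E -> G) :=
  \bigcup_(phi in M) hyp_class (f \o phi).

Lemma hyp_push_setE (phi : r.-tuple E -> F) :
  hyp_push_set (hyp_class phi) = hyp_class (f \o phi).
Proof.
apply/seteqP; split=> [rho [psi /hyp_class_push /hyp_class_eq <-] //|rho hrho].
by exists phi => //; apply: hyp_class_refl.
Qed.

Lemma hyp_pushP (M : hyp_matroid F) :
  exists2 phi, is_hyp_gp phi & hyp_push_set M = hyp_class phi.
Proof.
case: M => M [phi gp e]; subst M; exists (f \o phi); first exact: hyp_gp_push.
exact: hyp_push_setE.
Qed.

Definition hyp_push (M : hyp_matroid F) : hyp_matroid G := HypMatroid (hyp_pushP M).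

Lemma hyp_pushE (phi : r.-tuple E -> F) (gp : is_hyp_gp phi) :
  hyp_push (hyp_matroid_of gp) = hyp_matroid_of (hyp_gp_push gp).
Proof. by apply: hmat_eq; apply: hyp_push_setE. Qed.

End Pushforward.

Lemma hyp_push_id (F : hyperfield) : hyp_push (hf_id F) = id.
Proof.
apply/funext=> -[M [phi gp e]]; subst M.
by apply: hmat_eq; apply: hyp_push_setE.
Qed.

Lemma hyp_push_comp (F G H : hyperfield) (g : hf_hom G H) (f : hf_hom F G) :
  hyp_push (hf_comp g f) = (fun M => hyp_push g (hyp_push f M)).
Proof.
apply/funext=> -[M [phi gp e]]; subst M; apply: hmat_eq => /=.
by rewrite !hyp_push_setE.
Qed.

Definition hyp_matroids : functor Hyperfields Sets :=
  @Functor Hyperfields Sets hyp_matroid hyp_push hyp_push_id hyp_push_comp.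

End HyperfieldMatroids.

Section FuzzyMatroids.
Variables (E : finType) (r : nat).

Record is_fuzzy_gp (K : fuzzy_ring) (phi : r.-tuple E -> K) : Prop := {
  fgp_val : forall x, funit (phi x) \/ phi x = fzero;
  fgp_neq0 : exists x, phi x <> fzero;
  fgp_odd : forall x (s : 'S_r), odd_perm s ->
    phi (perm_args x s) = fmul feps (phi x);
  fgp_uniq : forall x : r.-tuple E, ~~ uniq x -> phi x = fzero;
  fgp_plucker : forall (x : r.+1.-tuple E) (y : r.-1.-tuple E),
    fnull (\big[@fadd K/fzero]_(k < r.+1)
      fmul (fmul (fexp feps k.+1) (phi (omit k x)))
           (phi (prepend (tnth x k) y))) }.

Definition fuzzy_class (K : fuzzy_ring) (phi : r.-tuple E -> K) :
    set (r.-tuple E -> K) :=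
  [set psi | exists2 u, funit u & psi = (fun x => fmul u (phi x))].

Record fuzzy_matroid (K : fuzzy_ring) := FuzzyMatroid {
  fmat_set :> set (r.-tuple E -> K);
  fmatP : exists2 phi, is_fuzzy_gp phi & fmat_set = fuzzy_class phi }.

Definition fuzzy_matroid_of (K : fuzzy_ring) (phi : r.-tuple E -> K)
    (gp : is_fuzzy_gp phi) : fuzzy_matroid K :=
  FuzzyMatroid (ex_intro2 _ _ phi gp erefl).

Lemma fmat_eq (K : fuzzy_ring) (M N : fuzzy_matroid K) :
  (M : set _) = N -> M = N.
Proof.
by case: M N => [M hM] [N hN] /= MN; subst N; congr FuzzyMatroid; apply: Prop_irrelevance.
Qed.

Lemma fuzzy_class_refl (K : fuzzy_ring) (phi : r.-tuple E -> K) :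
  fuzzy_class phi phi.
Proof.
by exists fone; [exact: funit1 | apply/funext=> x; rewrite fmul1x].
Qed.

Lemma fuzzy_class_eq (K : fuzzy_ring) (phi psi : r.-tuple E -> K) :
  fuzzy_class phi psi -> fuzzy_class psi = fuzzy_class phi.
Proof.
move=> [u u0 ->]; have [v uv] := u0.
have v0 : funit v by exists u; rewrite fmulC.
apply/seteqP; split=> _ [w w0 ->].
  exists (fmul w u); first exact: funitM.
  by apply/funext=> x; rewrite fmulA.
exists (fmul w v); first exact: funitM.
by apply/funext=> x; rewrite fmulA -(fmulA w) (fmulC v) uv fmulx1.
Qed.

Section Pushforward.
Variables (K L : fuzzy_ring) (f : weak_morphism K L).

Lemma fuzzy_gp_push (phi : r.-tuple E -> K) :
  is_fuzzy_gp phi -> is_fuzzy_gp (wm_ext f \o phi).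
Proof.
move=> [val [x0 hx0] odd dup pl]; split.
- move=> x /=; case: (val x) => [/(wm_ext_funit f)|->]; first by left.
  by right; rewrite wm_ext0.
- exists x0 => /=; case: (val x0) => [ux|x00]; last by case: hx0.
  by apply/funit_neq0/wm_ext_funit.
- move=> x s /odd /= ->; rewrite wm_extM ?wm_ext_eps //.
  by left; apply: funit_eps.
- by move=> x /dup /= ->; rewrite wm_ext0.
move=> x y; have ueps n : funit (fexp feps n : K).
  by apply/funit_exp/funit_eps.
have mval a b : (funit a \/ a = fzero) -> (funit b \/ b = fzero) ->
    funit (fmul a b) \/ fmul a b = fzero :> K.
  case=> [ua|->]; last by rewrite fmul0x; right.
  by case=> [ub|->]; [left; apply: funitM | rewrite fmulx0; right].
have tval (k : 'I_r.+1) : let t := fmul (fmul (fexp feps k.+1) (phi (omit k x)))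
    (phi (prepend (tnth x k) y)) in funit t \/ t = fzero.
  by apply: (mval _ _ (mval _ _ _ _)) => //; left.
have := wm_ext_null f tval (pl x y).
rewrite (eq_bigr (fun k : 'I_r.+1 =>
  fmul (fmul (fexp feps k.+1) (wm_ext f (phi (omit k x))))
       (wm_ext f (phi (prepend (tnth x k) y))))) // => k _.
have eval n : funit (fexp feps n : K) \/ fexp feps n = fzero :> K by left.
rewrite (wm_extM f (mval _ _ (eval _) (val _)) (val _)).
by rewrite (wm_extM f (eval _) (val _)) wm_ext_eps_exp.
Qed.

Lemma fuzzy_class_push (phi psi : r.-tuple E -> K) : is_fuzzy_gp phi ->
  fuzzy_class phi psi -> fuzzy_class (wm_ext f \o phi) (wm_ext f \o psi).
Proof.
move=> gp [u u0 ->]; exists (wm_ext f u); first exact: wm_ext_funit.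
by apply/funext=> x /=; rewrite wm_extM //; [left | apply: fgp_val].
Qed.

Definition fuzzy_push_set (M : set (r.-tuple E -> K)) : set (r.-tuple E -> L) :=
  \bigcup_(phi in M) fuzzy_class (wm_ext f \o phi).

Lemma fuzzy_push_setE (phi : r.-tuple E -> K) : is_fuzzy_gp phi ->
  fuzzy_push_set (fuzzy_class phi) = fuzzy_class (wm_ext f \o phi).
Proof.
move=> gp; apply/seteqP; split=> [rho [psi]|rho hrho].
  by move=> /(fuzzy_class_push gp) /fuzzy_class_eq <-.
by exists phi => //; apply: fuzzy_class_refl.
Qed.

Lemma fuzzy_pushP (M : fuzzy_matroid K) :
  exists2 phi, is_fuzzy_gp phi & fuzzy_push_set M = fuzzy_class phi.
Proof.
case: M => M [phi gp e]; subst M; exists (wm_ext f \o phi); first exact: fuzzy_gp_push.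
exact: fuzzy_push_setE.
Qed.

Definition fuzzy_push (M : fuzzy_matroid K) : fuzzy_matroid L :=
  FuzzyMatroid (fuzzy_pushP M).

Lemma fuzzy_pushE (phi : r.-tuple E -> K) (gp : is_fuzzy_gp phi) :
  fuzzy_push (fuzzy_matroid_of gp) = fuzzy_matroid_of (fuzzy_gp_push gp).
Proof. by apply: fmat_eq; apply: fuzzy_push_setE. Qed.

End Pushforward.

Lemma fuzzy_push_id (K : fuzzy_ring) : fuzzy_push (wm_id K) = id.
Proof.
apply/funext=> -[M [phi gp e]]; subst M; apply: fmat_eq => /=.
rewrite fuzzy_push_setE //; congr fuzzy_class; apply/funext=> x /=.
by apply: wm_ext_id; apply: fgp_val.
Qed.

Lemma fuzzy_push_comp (K L M : fuzzy_ring) (g : weak_morphism L M)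
    (f : weak_morphism K L) :
  fuzzy_push (wm_comp g f) = (fun X => fuzzy_push g (fuzzy_push f X)).
Proof.
apply/funext=> -[X [phi gp e]]; subst X; apply: fmat_eq => /=.
rewrite !fuzzy_push_setE //; last exact: fuzzy_gp_push.
by congr fuzzy_class; apply/funext=> x /=; apply: wm_ext_comp.
Qed.

Definition fuzzy_matroids : functor FuzzyRings_wk Sets :=
  @Functor FuzzyRings_wk Sets fuzzy_matroid fuzzy_push fuzzy_push_id fuzzy_push_comp.

End FuzzyMatroids.

(* Main.v *)
Require Import Defs.
From mathcomp Require Import all_boot.
From mathcomp Require Import boolp classical_sets.

(** The map [psingle] from a hyperfield [F] to [fuzzy_powerset F] is injective,
    and its image consists exactly of the units and the zero element, which are
    the only values that a fuzzy Grassmann-Plucker function may take.  Hence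
    composing with [psingle] is a bijection from all functions with values in
    [F] to the functions with values in units and zero ([unit_or_zero_psingle]).  It
    respects Grassmann-Plucker functions in both directions ([psingle_gpE]):
    [psingle] is multiplicative and sends [-1] to the element epsilon, and the
    sum of singletons in the powerset is by definition their hypersum, so that
    being null says that the hypersum contains [0].  It also matches the orbits
    of the scalings by units ([fuzzy_class_psingle]), since the units on both
    sides correspond.  A matroid being such an orbit, direct and inverse images
    of sets of functions under this composition are mutually inverse maps
    between matroids over [F] and over [fuzzy_powerset F].  Naturality holds
    because the weak morphism induced by [f] sends [{x}] to [{f x}], for [x]
    zero too ([wm_ext_powerset_map]). *)

Set Implicit Arguments.
Unset Strict Implicit.
Unset Printing Implicit Defensive.

Local Open Scope classical_set_scope.

Section Singletons.
Variable F : hyperfield.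
Implicit Types x y : F.

Lemma psingle_inj : injective (@psingle F).
Proof. by move=> x y /(congr1 (@pset_set F)) /= /seteqP[/(_ x erefl)]. Qed.

Lemma funit_psingle x : funit (psingle x : fuzzy_powerset F) <-> x <> hzero.
Proof.
rewrite /funit; split=> [/psetM_unitP[y y0 /psingle_inj ->] //|x0].
by apply/psetM_unitP; exists x.
Qed.

Lemma psingle_val x : funit (psingle x : fuzzy_powerset F) \/
  (psingle x : fuzzy_powerset F) = fzero.
Proof.
have [->|x0] := pselect (x = hzero); first by right.
by left; apply/funit_psingle.
Qed.

Lemma fmul_psingle x y :
  fmul (psingle x : fuzzy_powerset F) (psingle y) = psingle (hmul x y).
Proof. exact: psetM_single. Qed.

Lemma fexp_eps n :
  fexp (feps : fuzzy_powerset F) n = psingle (hexp (hopp hone) n).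
Proof. by elim: n => [|n IHn] //=; rewrite IHn; exact: psetM_single. Qed.

Lemma pset_null_sum n (t : 'I_n -> fuzzy_powerset F) :
  fnull (\big[@fadd (fuzzy_powerset F)/fzero]_(k < n) t k) =
  (\big[@hsetD F/[set hzero]]_(k < n) (t k : pset F)) hzero.
Proof. by congr (_ hzero); exact: (big_morph (@pset_set F)). Qed.

End Singletons.

(** The extension of a weak morphism to zero sends zero to zero by convention,
    so the zero singleton needs [f 0 = 0]. *)
Lemma wm_ext_powerset_map (F G : hyperfield) (f : hf_hom F G) (x : F) :
  wm_ext (powerset_map f) (psingle x) = psingle (f x).
Proof.
have [->|/funit_psingle ux] := pselect (x = hzero).
  by rewrite hf_hom0; exact: wm_ext0.
by rewrite (wm_ext_unit _ ux); exact: pimage_single.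
Qed.

Section MatroidsOverPowerset.
Variables (E : finType) (r : nat) (F : hyperfield).
Implicit Types (phi : r.-tuple E -> F) (psi : r.-tuple E -> fuzzy_powerset F).

Definition psingle_fun phi : r.-tuple E -> fuzzy_powerset F :=
  fun x => psingle (phi x).

Lemma psingle_fun_inj : injective psingle_fun.
Proof. by move=> phi1 phi2 /funeqP e; apply/funext=> x; apply/psingle_inj/e. Qed.

(** Surjectivity half of the correspondence: the units of the powerset are
    singletons of nonzero elements, so a value constrained to be a unit or zero
    is a singleton, and [phi] is obtained by choosing its element pointwise. *)
Lemma unit_or_zero_psingle psi : (forall x, funit (psi x) \/ psi x = fzero) ->
  exists phi, psi = psingle_fun phi.
Proof.
move=> val; suff /choice[phi e] : forall x, exists a, psi x = psingle a.
  by exists phi; apply/funext.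
by move=> x; have [/psetM_unitP[a _ ->]|->] := val x; [exists a|exists hzero].
Qed.

Lemma psingle_pluckerE phi (x : r.+1.-tuple E) (y : r.-1.-tuple E) :
  fnull (\big[@fadd (fuzzy_powerset F)/fzero]_(k < r.+1)
      fmul (fmul (fexp feps k.+1) (psingle_fun phi (omit k x)))
           (psingle_fun phi (prepend (tnth x k) y))) <->
  (\big[@hsetD F/[set hzero]]_(k < r.+1)
       [set hmul (hmul (hexp (hopp hone) k.+1) (phi (omit k x)))
                 (phi (prepend (tnth x k) y))]) hzero.
Proof.
rewrite pset_null_sum; under eq_bigr => k _ do rewrite fexp_eps !fmul_psingle.
by [].
Qed.

(** Each axiom transfers separately, through the identities for signs, products
    and sums of singletons; injectivity of [psingle] brings equations back to
    [F]. *)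
Lemma psingle_gpE phi : is_fuzzy_gp (psingle_fun phi) <-> is_hyp_gp phi.
Proof.
split=> [[_ [x0 nz] odd dup pl]|[[x0 nz] odd dup pl]]; split.
- by exists x0 => e; apply: nz; rewrite /psingle_fun e.
- move=> x s /odd e; apply: psingle_inj.
  by rewrite -hmulN1x -psetM_single; exact: e.
- by move=> x /dup; exact: psingle_inj.
- by move=> x y; apply/psingle_pluckerE/pl.
- by move=> x; exact: psingle_val.
- by exists x0 => /psingle_inj.
- by move=> x s /odd e; rewrite /psingle_fun e -hmulN1x -psetM_single.
- by move=> x /dup e; rewrite /psingle_fun e.
- by move=> x y; apply/psingle_pluckerE/pl.
Qed.

(** Scaling by the unit [{u}] on the fuzzy side is scaling by [u] on the
    hyperfield side, and every unit has this form, so an orbit goes to a whole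
    orbit and not only into one. *)
Lemma fuzzy_class_psingle phi :
  fuzzy_class (psingle_fun phi) = psingle_fun @` hyp_class phi.
Proof.
have scale u : (fun x => fmul (psingle u : fuzzy_powerset F) (psingle_fun phi x))
    = psingle_fun (fun x => hmul u (phi x)).
  by apply/funext=> x; exact: psetM_single.
apply/seteqP; split=> [_ [_ /psetM_unitP[u u0 ->] ->]|_ [_ [u u0 ->] <-]].
  by rewrite scale; exists (fun x => hmul u (phi x)) => //; exists u.
by exists (psingle u); [exact/funit_psingle | rewrite scale].
Qed.

Lemma psingle_class_preimage phi :
  psingle_fun @^-1` fuzzy_class (psingle_fun phi) = hyp_class phi.
Proof.
rewrite fuzzy_class_psingle; apply/seteqP; split=> [rho [rho' h]|rho h].
  by move=> /psingle_fun_inj <-.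
by exists rho.
Qed.

Lemma hyp_to_fuzzyP (M : hyp_matroid E r F) :
  exists2 psi, is_fuzzy_gp psi & psingle_fun @` M = fuzzy_class psi.
Proof.
have [phi gp ->] := hmatP M; exists (psingle_fun phi); first exact/psingle_gpE.
by rewrite fuzzy_class_psingle.
Qed.

(** Inverse images define the map back with no choice of representative: every
    function in a fuzzy matroid is singleton-valued, so none is lost. *)
Lemma fuzzy_to_hypP (N : fuzzy_matroid E r (fuzzy_powerset F)) :
  exists2 phi, is_hyp_gp phi & psingle_fun @^-1` N = hyp_class phi.
Proof.
have [psi gp ->] := fmatP N.
have [phi e] := unit_or_zero_psingle (fgp_val gp); rewrite e in gp *.
by exists phi; [exact/psingle_gpE | exact: psingle_class_preimage].
Qed.

Definition hyp_to_fuzzy (M : hyp_matroid E r F) :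
  fuzzy_matroid E r (fuzzy_powerset F) := FuzzyMatroid (hyp_to_fuzzyP M).

Definition fuzzy_to_hyp (N : fuzzy_matroid E r (fuzzy_powerset F)) :
  hyp_matroid E r F := HypMatroid (fuzzy_to_hypP N).

Lemma hyp_to_fuzzyK : cancel hyp_to_fuzzy fuzzy_to_hyp.
Proof.
move=> M; apply: hmat_eq => /=; have [phi _ ->] := hmatP M.
by rewrite -fuzzy_class_psingle psingle_class_preimage.
Qed.

Lemma fuzzy_to_hypK : cancel fuzzy_to_hyp hyp_to_fuzzy.
Proof.
move=> N; apply: fmat_eq => /=; have [psi gp ->] := fmatP N.
have [phi ->] := unit_or_zero_psingle (fgp_val gp).
by rewrite psingle_class_preimage fuzzy_class_psingle.
Qed.

Lemma hyp_to_fuzzyE phi (gp : is_hyp_gp phi)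
    (gp' : is_fuzzy_gp (psingle_fun phi)) :
  hyp_to_fuzzy (hyp_matroid_of gp) = fuzzy_matroid_of gp'.
Proof. by apply: fmat_eq => /=; rewrite fuzzy_class_psingle. Qed.

End MatroidsOverPowerset.

(** On a representative, both sides are the orbit of the function sending [x]
    to the singleton of [f (phi x)]. *)
Lemma hyp_to_fuzzy_natural (E : finType) (r : nat) (F G : hyperfield)
    (f : hf_hom F G) (M : hyp_matroid E r F) :
  hyp_to_fuzzy (hyp_push f M) = fuzzy_push (powerset_map f) (hyp_to_fuzzy M).
Proof.
apply: fmat_eq => /=; have [phi gp ->] := hmatP M.
rewrite hyp_push_setE -!fuzzy_class_psingle.
rewrite fuzzy_push_setE; last exact/psingle_gpE.
suff -> : wm_ext (powerset_map f) \o psingle_fun phi = psingle_fun (f \o phi) by [].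
by apply/funext=> x; exact: wm_ext_powerset_map.
Qed.

Definition hyp_fuzzy_iso (E : finType) (r : nat) :
  nat_iso (hyp_matroids E r)
    (functor_comp (fuzzy_matroids E r) powerset_functor).
Proof.
apply: (@NatIso Hyperfields Sets (hyp_matroids E r)
  (functor_comp (fuzzy_matroids E r) powerset_functor)
  (fun F => @hyp_to_fuzzy E r F)).
- by move=> F G f; apply/funext=> M; exact: hyp_to_fuzzy_natural.
- move=> F; exists (@fuzzy_to_hyp E r F).
  by split; apply/funext; [exact: hyp_to_fuzzyK | exact: fuzzy_to_hypK].
Defined.

Theorem theorem2 (E : finType) (r : nat) (E_gt0 : 0 < #|E|) (r_gt0 : 0 < r) :
  (exists eta : nat_iso (hyp_matroids E r)
                  (functor_comp (fuzzy_matroids E r) powerset_functor),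
     forall (F : hyperfield) (phi : r.-tuple E -> F) (gp : is_hyp_gp phi),
       exists gp' : is_fuzzy_gp (K := fuzzy_powerset F) (fun x => psingle (phi x)),
         component eta F (hyp_matroid_of gp) = fuzzy_matroid_of gp')
  /\ (forall F : hyperfield,
        exists b : hyp_matroid E r F -> fuzzy_matroid E r (fuzzy_powerset F),
          bijective b).
Proof.
split.
  exists (hyp_fuzzy_iso E r) => F phi gp.
  have gp' := (psingle_gpE phi).2 gp.
  by exists gp'; exact: hyp_to_fuzzyE.
move=> F; exists (@hyp_to_fuzzy E r F).
by exists (@fuzzy_to_hyp E r F); [exact: hyp_to_fuzzyK | exact: fuzzy_to_hypK].
Qed.
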